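(* There is an algorithm solving the $(\epsilon,\delta)$-winner determination problem for the $k$-approval voting rule with sample complexity $O\!\left(\frac{\log(k/\delta)}{\epsilon^2}\right)$.
   Context: An election has $n$ voters and $m$ candidates, each vote a complete linear order over the candidates. Under the $k$-approval rule, a candidate receives one point from each vote in which it is among the top $k$ positions, and the candidate with the maximum score wins (ties broken by an arbitrary fixed rule); $1$-approval is plurality. The margin of victory (MOV) is the smallest number of votes that must be changed (others kept unchanged) to change the winner. The $(\epsilon,\delta)$-winner determination problem: given the $n$ votes with MOV at least $\epsilon n$, output the winner with probability at least $1-\delta$ over the algorithm's internal randomness; the algorithm may query full votes of arbitrary voters, and the sample complexity is the number of queried votes.
   Formalization: The constant in the O is uniform wherever log(k/δ) is bounded below by a fixed positive number (automatic for k ≥ 2; for k = 1, δ bounded away from 1), since for k = 1 and δ → 1 the bound would drop below one query and fail. *)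

(* Defs.v *)
From HB Require Import structures.
From mathcomp Require Import all_boot all_order all_algebra all_fingroup.
From mathcomp Require Import reals constructive_ereal exp.

Set Implicit Arguments.
Unset Strict Implicit.
Unset Printing Implicit Defensive.

Import Order.TTheory GRing.Theory Num.Theory.
Local Open Scope ring_scope.

(* The linear order is given by its rank function: [v c] is the position of
   candidate [c] in the vote [v], and position 0 is the top. *)
Definition vote (m : nat) := {perm 'I_m}.

Definition profile (n m : nat) := {ffun 'I_n -> vote m}.

Definition approves (m k : nat) (v : vote m) (c : 'I_m) : bool := (v c < k)%N.

Definition score (n m k : nat) (P : profile n m) (c : 'I_m) : nat :=
  #|[set i : 'I_n | approves k (P i) c]|.

Definition cowinners (n m k : nat) (P : profile n m) : {set 'I_m} :=
  [set c | [forall d : 'I_m, (score k P d <= score k P c)%N]].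

(* A tie-breaking rule sees only the set of tied candidates; a fixed priority
   order on the candidates is a particular case. *)
Definition tie_breaking (m : nat) (t : {set 'I_m} -> 'I_m) : Prop :=
  forall S : {set 'I_m}, S != set0 -> t S \in S.

Definition winner (n m k : nat) (t : {set 'I_m} -> 'I_m) (P : profile n m) :
    'I_m :=
  t (cowinners k P).

Definition num_changed (n m : nat) (P Q : profile n m) : nat :=
  #|[set i : 'I_n | P i != Q i]|.

(* The value is +oo when no change of votes changes the winner, as happens for
   k = m or n = 0. *)
Definition margin_of_victory (R : realType) (n m k : nat)
    (t : {set 'I_m} -> 'I_m) (P : profile n m) : \bar R :=
  \big[Order.min/+oo%E]_(Q : profile n m | winner k t Q != winner k t P)
    (num_changed P Q)%:R%:E.

(* Randomized adaptive query algorithms: the full vote of a voter is obtained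
   by [Query], and internal randomness by [Draw p], which draws an element of
   {0, ..., p} uniformly and independently of everything before. *)
Inductive algorithm (n m : nat) : Type :=
  | Output of 'I_m
  | Draw (p : nat) of ('I_p.+1 -> algorithm n m)
  | Query of 'I_n & (vote m -> algorithm n m).

Fixpoint prob_output (R : realType) (n m : nat) (a : algorithm n m)
    (P : profile n m) (c : 'I_m) : R :=
  match a with
  | Output d => (d == c)%:R
  | Draw p f => (\sum_(j < p.+1) prob_output R (f j) P c) / p.+1%:R
  | Query i f => prob_output R (f (P i)) P c
  end.

(* Repeated queries to the same voter are counted each time. *)
Fixpoint num_queries (n m : nat) (a : algorithm n m) (P : profile n m) : nat :=
  match a with
  | Output _ => 0%N
  | Draw p f => (\max_(j < p.+1) num_queries (f j) P)%N
  | Query i f => (num_queries (f (P i)) P).+1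
  end.

Definition sample_complexity (n m : nat) (a : algorithm n m) : nat :=
  (\max_(P : profile n m) num_queries a P)%N.

Definition solves_winner_determination (R : realType) (n m k : nat)
    (t : {set 'I_m} -> 'I_m) (eps delta : R) (a : algorithm n m) : Prop :=
  forall P : profile n m,
    ((eps * n%:R)%:E <= margin_of_victory R k t P)%E ->
    1 - delta <= prob_output R a P (winner k t P).

(* Main.v *)
Require Import Defs.
From HB Require Import structures.
From mathcomp Require Import all_boot all_order all_algebra all_fingroup.
From mathcomp Require Import archimedean ring lra zify.
From mathcomp Require Import reals constructive_ereal sequences exp.

Set Implicit Arguments.
Unset Strict Implicit.
Unset Printing Implicit Defensive.

Import Order.TTheory GRing.Theory Num.Theory.
Local Open Scope ring_scope.

(* Replacing one vote that does not already favour [c] over the winner [w] by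
   one approving [c] but not [w] closes their gap by at least 1, so a margin
   of [eps * n] forces [score w - score c >= eps * n - 1 >= eps * n / 2] as soon
   as [eps * n >= 2]. Then [O((ln (k / delta) + 1) / eps ^ 2)] votes drawn with
   replacement suffice: a threshold slightly below the expected score of [w]
   separates [w] from all others. The exponential moment bound for the event
   that [c] passes the threshold is proportional to the approval rate of [c],
   and the approval rates sum to at most [k]; this gives [ln k] rather than
   [ln m]. *)

(** * Margin of victory and score gaps *)

Lemma scoreE (n m k : nat) (P : profile n m) (c : 'I_m) :
  score k P c = (\sum_i approves k (P i) c)%N.
Proof. by rewrite -big_mkcond sum1dep_card; apply: eq_card => i; rewrite inE. Qed.

(** Put [c] at the top, then swap [w] into the last position, which is not approved because
    [k < m]. *)
Lemma exists_separating_vote (m k : nat) (c w : 'I_m) :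
  (0 < k < m)%N -> c != w ->
  exists v : vote m, approves k v c && ~~ approves k v w.
Proof.
case: m c w => [|m] c w; first by rewrite ltn0 andbF.
case/andP=> k0 km cw.
have m0 : ord_max != ord0 :> 'I_m.+1.
  by apply/eqP => /(congr1 val) /=; move: k0 km; case: m {c w cw} => [|m] //; case: k.
pose v0 : vote m.+1 := tperm c ord0.
exists (v0 * tperm (v0 w) ord_max)%g.
rewrite /approves !permM tpermL (_ : v0 c = ord0) ?tpermL //.
rewrite tpermD //=; first by rewrite k0 -leqNgt.
by rewrite -(tpermL c ord0 : v0 c = ord0) (inj_eq perm_inj) eq_sym.
Qed.

Lemma num_changed_trans (n m : nat) (P Q S : profile n m) :
  (num_changed P S <= num_changed P Q + num_changed Q S)%N.
Proof.
rewrite /num_changed -cardsUI; apply: leq_trans (leq_addr _ _).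
apply/subset_leq_card/subsetP => i; rewrite !inE -negb_and.
by apply: contra => /andP[/eqP -> /eqP ->].
Qed.

(** Induction on [d]: replacing a vote that does not yet separate [c] from [w] gains at least 1. If
    every vote already separates them, [c] has all [n] approvals and [w] none, so [P] itself
    serves. *)
Lemma exists_overtaking_profile (n m k : nat) (c w : 'I_m) (d : nat)
    (P : profile n m) :
  (0 < n)%N -> (0 < k < m)%N -> c != w -> (score k P w < score k P c + d)%N ->
  exists2 Q : profile n m,
    (num_changed P Q <= d)%N & (score k Q w < score k Q c)%N.
Proof.
move=> n0 km cw; have [v /andP[vc vw]] := exists_separating_vote km cw.
elim: d P => [|d IH] P; rewrite ?addn0 => wc.
  by exists P => //; rewrite /num_changed eq_card0 // => i; rewrite !inE eqxx.
have [/forallP all_c|] := boolP [forall i, approves k (P i) c && ~~ approves k (P i) w].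
  exists P.
    by rewrite /num_changed eq_card0 // => i; rewrite !inE eqxx.
  rewrite !scoreE big1 => [|i _]; last by have /andP[_ /negbTE ->] := all_c i.
  rewrite (eq_bigr (fun=> 1%N)) => [|i _]; last by have /andP[-> _] := all_c i.
  by rewrite sum1_card card_ord.
rewrite negb_forall => /existsP[i Pi].
pose Q : profile n m := [ffun j => if j == i then v else P j].
have scoreQ x : (score k Q x + approves k (P i) x = score k P x + approves k v x)%N.
  rewrite !scoreE (bigD1 i) //= [X in (_ = X + _)%N] (bigD1 i) //= ffunE eqxx.
  rewrite (eq_bigr (fun j => approves k (P j) x : nat)).
    by rewrite addnC (addnC (approves k v x : nat)) addnA.
  by move=> j /negbTE ji; rewrite ffunE ji.
have [|S QS Sw] := IH Q.
  move: (scoreQ c) (scoreQ w) wc Pi; rewrite vc (negbTE vw).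
  by case: approves; case: approves => /=; lia.
exists S => //; apply: leq_trans (num_changed_trans P Q S) _.
rewrite -add1n leq_add // -(cards1 i) subset_leq_card //.
apply/subsetP => j; rewrite !inE ffunE; case: (j == i) => //.
by rewrite eqxx.
Qed.

Lemma winner_cowinner (n m k : nat) (t : {set 'I_m} -> 'I_m) (P : profile n m) :
  tie_breaking t -> winner k t P \in cowinners k P.
Proof.
move=> tt; apply: tt; apply/set0Pn.
(* The value at [set0] only shows that a candidate exists, to start the argmax. *)
have c0 : 'I_m := t set0.
exists [arg max_(c > c0) score k P c]; rewrite inE.
by case: arg_maxnP => // c _ cmax; apply/forallP => d; apply: cmax.
Qed.

(** The extra 1 makes [c] strictly overtake, which expels the winner from the cowinners under any
    tie-breaking; [c] itself need not win. *)
Lemma margin_of_victory_le_gap (R : realType) (n m k : nat)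
    (t : {set 'I_m} -> 'I_m) (P : profile n m) (c : 'I_m) :
  tie_breaking t -> (0 < n)%N -> (0 < k < m)%N -> c != winner k t P ->
  (margin_of_victory R k t P <=
     (score k P (winner k t P) - score k P c).+1%:R%:E)%E.
Proof.
move=> tt n0 km cw.
set d := _.+1.
have [|Q PQ Qw] := exists_overtaking_profile (d := d) (P := P) n0 km cw.
  by rewrite /d; lia.
apply: (@le_trans _ _ (num_changed P Q)%:R%:E); last by rewrite lee_fin ler_nat.
apply: bigmin_le_cond; apply/eqP => QP.
have := winner_cowinner k Q tt; rewrite QP inE => /forallP/(_ c).
by rewrite leqNgt Qw.
Qed.

(** * Winners of vote lists; exhaustive and sampling algorithms *)

Definition approvals (m k : nat) (s : seq (vote m)) (c : 'I_m) : nat :=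
  count (fun v : vote m => approves k v c) s.

Definition seq_winner (m k : nat) (t : {set 'I_m} -> 'I_m) (s : seq (vote m)) :
    'I_m :=
  t [set c | [forall d, (approvals k s d <= approvals k s c)%N]].

Lemma seq_winner_perm (n m k : nat) (t : {set 'I_m} -> 'I_m) (P : profile n m)
    (s : seq (vote m)) :
  perm_eq s [seq P i | i <- enum 'I_n] -> seq_winner k t s = winner k t P.
Proof.
move=> /seq.permP sP; congr t; apply/setP => c; rewrite !inE.
have E d : approvals k s d = score k P d.
  by rewrite /approvals /score sP count_map cardsE cardE size_filter enumT.
by apply: eq_forallb => d; rewrite !E.
Qed.

Lemma approvals_le_size (m k : nat) (s : seq (vote m)) (c : 'I_m) :
  (m <= k)%N -> approvals k s c = size s.
Proof.
move=> mk; apply/eqP; rewrite -all_count; apply/allP => v _.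
exact: leq_trans (ltn_ord _) mk.
Qed.

(** Every vote approves every candidate, so any list of votes leaves all candidates tied. *)
Lemma seq_winner_total (n m k : nat) (t : {set 'I_m} -> 'I_m) (P : profile n m)
    (s : seq (vote m)) :
  (m <= k)%N -> seq_winner k t s = winner k t P.
Proof.
move=> mk; have <- := seq_winner_perm k t (perm_refl [seq P i | i <- enum 'I_n]).
congr t; apply/setP => c; rewrite !inE.
by apply: eq_forallb => d; rewrite !approvals_le_size ?leqnn.
Qed.

Lemma seq_winner_unique (m k : nat) (t : {set 'I_m} -> 'I_m) (s : seq (vote m))
    (w : 'I_m) :
  tie_breaking t ->
  (forall c, c != w -> (approvals k s c < approvals k s w)%N) ->
  seq_winner k t s = w.
Proof.
move=> tt sw; rewrite /seq_winner.
suff -> : [set c | [forall d, (approvals k s d <= approvals k s c)%N]] = [set w].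
  by apply/set1P/tt/set0Pn; exists w; rewrite set11.
apply/setP => c; rewrite !inE; apply/forallP/eqP => [cmax|-> d].
  by apply/eqP; apply: contraT => /sw; rewrite ltnNge cmax.
by have [->//|/sw/ltnW] := eqVneq d w.
Qed.

Fixpoint read_votes (n m k : nat) (t : {set 'I_m} -> 'I_m) (vs : seq 'I_n)
    (s : seq (vote m)) : algorithm n m :=
  if vs is i :: vs' then Query i (fun v => read_votes k t vs' (v :: s))
  else Output n (seq_winner k t s).

Fixpoint sample_votes (n m k : nat) (t : {set 'I_m} -> 'I_m) (l : nat)
    (s : seq (vote m)) : algorithm n.+1 m :=
  if l is l'.+1 then
    Draw (fun j : 'I_n.+1 => Query j (fun v => sample_votes n k t l' (v :: s)))
  else Output n.+1 (seq_winner k t s).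

Lemma num_queries_read_votes (n m k : nat) (t : {set 'I_m} -> 'I_m)
    (vs : seq 'I_n) (s : seq (vote m)) (P : profile n m) :
  num_queries (read_votes k t vs s) P = size vs.
Proof. by elim: vs s => //= i vs IH s; rewrite IH. Qed.

Lemma num_queries_sample_votes (n m k : nat) (t : {set 'I_m} -> 'I_m)
    (l : nat) (s : seq (vote m)) (P : profile n.+1 m) :
  (num_queries (sample_votes n k t l s) P <= l)%N.
Proof.
elim: l s => //= l IH s; apply/bigmax_leqP => j _; exact: IH.
Qed.

Lemma prob_output_read_votes (R : realType) (n m k : nat)
    (t : {set 'I_m} -> 'I_m) (vs : seq 'I_n) (s : seq (vote m))
    (P : profile n m) (c : 'I_m) :
  prob_output R (read_votes k t vs s) P c
    = (seq_winner k t (rev [seq P i | i <- vs] ++ s) == c)%:R.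
Proof.
by elim: vs s => //= i vs IH s; rewrite IH rev_cons cat_rcons.
Qed.

Lemma prob_output_read_all (R : realType) (n m k : nat)
    (t : {set 'I_m} -> 'I_m) (P : profile n m) :
  prob_output R (read_votes k t (enum 'I_n) [::]) P (winner k t P) = 1.
Proof.
have Pp : perm_eq (rev [seq P i | i <- enum 'I_n]) [seq P i | i <- enum 'I_n].
  by rewrite perm_rev.
by rewrite prob_output_read_votes cats0 (seq_winner_perm k t Pp) eqxx.
Qed.

(* The second hypothesis makes [Phi] a supermartingale along the draws. *)
Lemma prob_output_sample_votes (R : realType) (n m k : nat)
    (t : {set 'I_m} -> 'I_m) (P : profile n.+1 m) (w : 'I_m)
    (Phi : nat -> seq (vote m) -> R) :
  (forall s, (seq_winner k t s != w)%:R <= Phi 0%N s) ->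
  (forall l s, (\sum_i Phi l (P i :: s)) / n.+1%:R <= Phi l.+1 s) ->
  forall l s, 1 - Phi l s <= prob_output R (sample_votes n k t l s) P w.
Proof.
move=> Phi0 PhiS; elim=> [|l IH] s /=.
  by have := Phi0 s; case: eqVneq => _ /=; lra.
apply: le_trans (_ : 1 - (\sum_i Phi l (P i :: s)) / n.+1%:R <= _).
  by rewrite lerB.
have n0 : 0 < n.+1%:R :> R by rewrite ltr0n.
rewrite -{1}(divff (lt0r_neq0 n0)) -mulrBl ler_pM2r ?invr_gt0 //.
rewrite -{1}[n.+1]card_ord -sumr_const -sumrB.
exact: ler_sum.
Qed.

(** * Exponential inequalities *)

(** From [expR (- x) >= 1 - x], since the right-hand side times [1 - x] is
    [1 + x ^+ 2 * (1 - 2 * x)], at least 1. *)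
Lemma expR_le_quadratic (R : realType) (x : R) :
  x <= 1 / 2 -> expR x <= 1 + x + 2 * x ^+ 2.
Proof.
move=> x2; have x1 : 0 < 1 - x by lra.
have E : expR x * expR (- x) = 1 by rewrite expRN divff // gt_eqF // expR_gt0.
have le1 : expR x * (1 - x) <= 1.
  by rewrite -[leRHS]E ler_wpM2l ?expR_ge0 // expR_ge1Dx.
by rewrite -(ler_pM2r x1); apply: le_trans le1 _; nra.
Qed.

(** Makes a tail bound proportional to the rate [u]. With [x = 1 / u >= 1] the exponent is at least
    [x + L + 1] in size, and [expR (- x) <= u], [expR (- 1) <= 1 / 2]. *)
Lemma expR_div_le (R : realType) (a u L : R) :
  0 < u <= 1 -> 0 <= L -> 8 * (L + 2) <= a ->
  expR (- (a / (8 * u))) <= u * (expR (- L) / 2).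
Proof.
move=> /andP[u0 u1] L0 aL; set x := u^-1.
have x1 : 1 <= x by rewrite invr_ge1 // unitfE gt_eqF.
have -> : a / (8 * u) = a / 8 * x by rewrite invfM mulrA.
apply: (@le_trans _ _ (expR (- x + - L + - 1))); first by rewrite ler_expR; nra.
have e1 : expR (- 1) <= 1 / 2 :> R.
  rewrite expRN div1r lef_pV2 ?posrE ?expR_gt0 //.
  by apply: le_trans (expR_ge1Dx 1); lra.
have ex : expR (- x) <= u.
  rewrite expRN -[u]invrK lef_pV2 ?posrE ?expR_gt0 ?invr_gt0 //.
  by apply: le_trans (expR_ge1Dx _); rewrite lerDr.
rewrite !expRD -mulrA ler_pM ?expR_ge0 ?mulr_ge0 ?expR_ge0 //.
by rewrite ler_wpM2l ?expR_ge0 // -div1r.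
Qed.

(* Convexity in [q], vanishing at [q = 0]. *)
Lemma exprn_sub1_le_chord (R : realType) (q u x : R) (l : nat) :
  0 <= q <= u -> 0 < u -> 0 <= x ->
  (1 + q * x) ^+ l - 1 <= q / u * ((1 + u * x) ^+ l - 1).
Proof.
move=> /andP[q0 qu] u0 x0; rewrite !subrX1.
have E y : 1 + y * x - 1 = y * x by rewrite addrC addKr.
rewrite !E mulrA [q / u * _]mulrA divfK ?gt_eqF //.
apply: ler_wpM2l; first exact: mulr_ge0.
apply: ler_sum => i _; apply: lerXn2r; rewrite ?nnegrE.
- by rewrite addr_ge0 // mulr_ge0.
- by rewrite addr_ge0 // mulr_ge0 // (le_trans q0).
- by rewrite lerD2l ler_wpM2r.
Qed.

(** * Approval rates and their moment generating functions *)

Lemma sum_approves_le (m k : nat) (v : vote m) :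
  (\sum_c approves k v c <= k)%N.
Proof.
rewrite (reindex_inj (perm_inj (s := v^-1%g))) /=.
rewrite (eq_bigr (fun c : 'I_m => (c < k)%N : nat)) => [|c _]; last first.
  by rewrite /approves permKV.
(* The sharper bound [minn m k] is what passes through the induction on [m]. *)
apply: leq_trans (geq_minr m k).
elim: m {v} => [|m IH]; first by rewrite big_ord0.
rewrite big_ord_recr /=; apply: leq_trans (leq_add IH (leqnn _)) _.
by case: (ltnP m k) => /= ?; lia.
Qed.

Definition approval_rate (R : realType) (n m k : nat) (P : profile n m)
    (c : 'I_m) : R := (score k P c)%:R / n%:R.

Lemma approval_rate_ge0 (R : realType) (n m k : nat) (P : profile n m)
    (c : 'I_m) : 0 <= approval_rate R k P c.
Proof. by rewrite divr_ge0. Qed.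

Lemma approval_rate_le1 (R : realType) (n m k : nat) (P : profile n.+1 m)
    (c : 'I_m) : approval_rate R k P c <= 1.
Proof.
rewrite /approval_rate ler_pdivrMr ?ltr0n // mul1r ler_nat.
by apply: leq_trans (max_card _) _; rewrite card_ord.
Qed.

Lemma sum_approval_rate_le (R : realType) (n m k : nat) (P : profile n.+1 m) :
  \sum_c approval_rate R k P c <= k%:R.
Proof.
rewrite -mulr_suml ler_pdivrMr ?ltr0n // -natr_sum -natrM ler_nat.
rewrite (eq_bigr _ (fun c _ => scoreE k P c)) exchange_big /=.
apply: leq_trans (leq_sum _ (fun i _ => sum_approves_le k (P i))) _.
by rewrite sum_nat_const card_ord mulnC.
Qed.

(** The expectation of [expR (x * b)], where the bit [b] tells whether a uniformly drawn voter
    approves [c]. *)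
Definition approval_mgf (R : realType) (n m k : nat) (P : profile n m) (x : R)
    (c : 'I_m) : R := 1 + approval_rate R k P c * (expR x - 1).

Lemma approval_mgf_mean (R : realType) (n m k : nat) (P : profile n.+1 m)
    (x : R) (c : 'I_m) (s : seq (vote m)) :
  (\sum_i expR x ^+ approvals k (P i :: s) c) / n.+1%:R
    = expR x ^+ approvals k s c * approval_mgf k P x c.
Proof.
have E i : expR x ^+ approvals k (P i :: s) c =
    expR x ^+ approvals k s c * (1 + (approves k (P i) c)%:R * (expR x - 1)).
  rewrite /approvals /= exprD mulrC; congr (_ * _).
  by case: approves => /=; rewrite ?expr1 ?expr0; ring.
rewrite (eq_bigr _ (fun i _ => E i)) -mulr_sumr -mulrA; congr (_ * _).
rewrite big_split /= sumr_const card_ord -mulr_suml -natr_sum -scoreE.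
by rewrite mulrDl divff ?pnatr_eq0 // /approval_mgf mulrAC.
Qed.

Lemma expR_cst_exprn (R : realType) (a y : R) (l : nat) (z : R) :
  0 <= y <= expR z -> expR a * y ^+ l <= expR (a + l%:R * z).
Proof.
move=> /andP[y0 yz]; rewrite expRD expRM_natl ler_wpM2l ?expR_ge0 //.
by rewrite lerXn2r ?nnegrE ?expR_ge0.
Qed.

Lemma mgf_bound (R : realType) (q x : R) :
  0 <= q <= 1 -> x <= 1 / 2 ->
  0 <= 1 + q * (expR x - 1) <= expR (q * (x + 2 * x ^+ 2)).
Proof.
move=> /andP[q0 q1] x2; apply/andP; split.
  by have := expR_ge0 x; nra.
apply: le_trans (expR_ge1Dx _); rewrite lerD2l ler_wpM2l //.
by have := expR_le_quadratic x2; lra.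
Qed.

(** * Failure probability of sampling *)

Section Sampling.
Variables (R : realType) (n m k : nat) (t : {set 'I_m} -> 'I_m).
Variables (P : profile n.+1 m) (w : 'I_m).
Hypothesis tt : tie_breaking t.

(* The sample fails only if [w] gets fewer than [T] approvals or some rival at
   least [T]. Both events are bounded by exponential moments; subtracting 1
   from the second kind makes the bound proportional to the approval rate of
   the rival, so that the union over the rivals costs [k] and not [m]. *)
Definition failure_potential (x y T : R) (l : nat) (s : seq (vote m)) : R :=
  expR (x * T) * (expR (- x) ^+ approvals k s w * approval_mgf k P (- x) w ^+ l)
  + \sum_(c | c != w)
      (expR y ^+ approvals k s c * approval_mgf k P y c ^+ l - 1)
        / (expR (y * T) - 1).

(** With no draws left, the first term is at least 1 if [w] is below [T], and a rival's summand is
    at least 1 if it reaches [T]; otherwise [w] strictly beats all rivals. *)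
Lemma failure_potential0 (x y T : R) (s : seq (vote m)) :
  0 < x -> 0 < y -> 0 < T ->
  (seq_winner k t s != w)%:R <= failure_potential x y T 0 s.
Proof.
move=> x0 y0 T0.
have M0 : 0 < expR (y * T) - 1 by rewrite subr_gt0 expR_gt1 mulr_gt0.
have term_ge0 c : 0 <= (expR y ^+ approvals k s c - 1) / (expR (y * T) - 1).
  by rewrite divr_ge0 ?(ltW M0) // subr_ge0 exprn_ege1 // ltW // expR_gt1.
rewrite /failure_potential expr0 mulr1.
under eq_bigr do rewrite expr0 mulr1.
have sum_ge0 := sumr_ge0 _ (fun c (_ : c != w) => term_ge0 c).
rewrite -expRM_natr -expRD.
have b1 (b : bool) : b%:R <= 1 :> R by case: b.
have [wT|Tw] := ltP (approvals k s w)%:R T.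
  apply: le_trans (b1 _) _; rewrite -[leLHS]addr0 lerD //.
  by rewrite -[leLHS]expR0 ler_expR mulNr -mulrBr mulr_ge0 // ?subr_ge0 ltW.
have [/existsP[c /andP[cw Tc]]|/existsPn noc] :=
  boolP [exists c, (c != w) && (T <= (approvals k s c)%:R)].
  apply: le_trans (b1 _) _; rewrite -[leLHS]add0r lerD ?expR_ge0 //.
  rewrite (bigD1 c) //= -[leLHS]addr0 lerD //; last exact: sumr_ge0.
  by rewrite ler_pdivlMr // mul1r lerB // -expRM_natr ler_expR ler_pM2l.
rewrite (seq_winner_unique tt (w := w)) ?eqxx ?addr_ge0 ?expR_ge0 //.
move=> c cw; rewrite -(ltr_nat R); apply: lt_le_trans Tw.
by have := noc c; rewrite cw /= -ltNge.
Qed.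

Lemma failure_potentialS (x y T : R) (l : nat) (s : seq (vote m)) :
  (\sum_i failure_potential x y T l (P i :: s)) / n.+1%:R
    = failure_potential x y T l.+1 s.
Proof.
have mean z c : (\sum_i expR z ^+ approvals k (P i :: s) c * approval_mgf k P z c ^+ l)
    / n.+1%:R = expR z ^+ approvals k s c * approval_mgf k P z c ^+ l.+1.
  by rewrite -mulr_suml mulrAC approval_mgf_mean -mulrA exprS.
rewrite /failure_potential big_split mulrDl /= -mulr_sumr -mulrA mean.
congr (_ + _); rewrite exchange_big mulr_suml /=; apply: eq_bigr => c _.
rewrite -mulr_suml mulrAC sumrB mulrBl mean.
by rewrite sumr_const card_ord divff ?pnatr_eq0.
Qed.

(** Per draw, the threshold [p - eta] lies [eta] below the rate of [w] and [eta] above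
    [u = p - 2 * eta], which bounds every rival's rate. Each of the two kinds of failure costs at
    most half of the bound. *)
Lemma failure_potential_le (eta L : R) (l : nat) (p := approval_rate R k P w) :
  (0 < k)%N -> 0 < eta -> 0 <= L -> 8 * (L + 2) <= l%:R * eta ^+ 2 ->
  4 * eta <= p ->
  (forall c, c != w -> approval_rate R k P c + 4 * eta <= p) ->
  failure_potential (eta / (4 * p)) (eta / (4 * (p - 2 * eta)))
    ((p - eta) * l%:R) l [::] <= k%:R * expR (- L).
Proof.
move=> k0 eta0 L0 lL pw gap.
have p1 : p <= 1 := approval_rate_le1 R k P w.
have [u uE] : exists u, u = p - 2 * eta by exists (p - 2 * eta).
rewrite -uE; have u0 : 0 < u by rewrite uE; lra.
have p0 : 0 < p by lra.
have k1 : 1 <= k%:R :> R by rewrite ler1n.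
set x := eta / (4 * p); set y := eta / (4 * u).
have xE : x * (4 * p) = eta by rewrite divfK // gt_eqF // mulr_gt0.
have yE : y * (4 * u) = eta by rewrite divfK // gt_eqF // mulr_gt0.
have x0 : 0 < x by rewrite divr_gt0 // mulr_gt0.
have y0 : 0 < y by rewrite divr_gt0 // mulr_gt0.
have y2 : y <= 1 / 2 by rewrite ler_pdivrMr ?mulr_gt0 //; lra.
(* The choice [z = eta / (4 * v)] minimises [2 * v * z ^+ 2 - z * eta], with value
   [- eta ^+ 2 / (8 * v)]. *)
have tail v z : 0 < v <= 1 -> z * (4 * v) = eta ->
    expR (l%:R * (2 * v * z ^+ 2 - z * eta)) <= v * (expR (- L) / 2).
  move=> v01 zE; apply: le_trans (expR_div_le v01 L0 lL); rewrite ler_expR -zE.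
  have v0 : v != 0 by case/andP: v01 => /gt_eqF ->.
  by rewrite le_eqVlt; apply/predU1P; left; field.
rewrite /failure_potential /= expr0 mul1r.
set c1 := expR (- L) / 2 in tail.
have c1_ge0 : 0 <= c1 by rewrite divr_ge0 ?expR_ge0.
have -> : k%:R * expR (- L) = k%:R * c1 + k%:R * c1 by rewrite /c1; field.
apply: lerD.
  apply: (@le_trans _ _ (p * c1)); last by nra.
  apply: le_trans (tail p x _ xE); last by rewrite p0.
  apply: le_trans (expR_cst_exprn _ _ (mgf_bound _ _)) _; rewrite ?(ltW p0) //.
    by lra.
  by rewrite ler_expR le_eqVlt -/p; apply/predU1P; left; ring.
set A := (1 + u * (expR y - 1)) ^+ l; set B := expR (y * ((p - eta) * l%:R)).
have u01 : 0 < u <= 1 by rewrite u0; lra.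
have l0 : 0 < l%:R :> R.
  by rewrite lt0r ler0n andbT; apply/eqP => l0; move: lL; rewrite l0; lra.
have B1 : 1 < B by rewrite expR_gt1 mulr_gt0 // mulr_gt0 //; lra.
have B0 : 0 < B := lt_trans ltr01 B1.
have AB : A <= B * (u * c1).
  rewrite mulrC -ler_pdivrMr //; apply: le_trans (tail u y u01 yE).
  rewrite /B -expRN mulrC; apply: le_trans (expR_cst_exprn _ _ (mgf_bound _ _)) _ => //.
    by lra.
  by rewrite ler_expR le_eqVlt uE; apply/predU1P; left; ring.
(* Subtracting 1 on both sides keeps the bound on [A / B], because [u * c1 <= 1]. *)
have ratio : (A - 1) / (B - 1) <= u * c1.
  have uc1 : u * c1 <= 1 by rewrite /c1; have := expR_le1 (- L); rewrite oppr_le0 L0; nra.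
  by rewrite ler_pdivrMr ?subr_gt0 //; nra.
(* By the chord bound a rival of rate [q] costs at most [q / u] times this ratio, so [u] cancels. *)
apply: (@le_trans _ _ (\sum_(c | c != w) approval_rate R k P c * c1)).
  apply: ler_sum => c cw; rewrite expr0 mul1r.
  have q0 := approval_rate_ge0 R k P c; have qu := gap c cw.
  apply: (@le_trans _ _ (approval_rate R k P c / u * ((A - 1) / (B - 1)))).
    rewrite mulrA ler_pM2r ?invr_gt0 ?subr_gt0 //.
    apply: exprn_sub1_le_chord => //; first by rewrite q0; lra.
    by rewrite subr_ge0 ltW // expR_gt1.
  apply: le_trans (ler_wpM2l _ ratio) _; first by rewrite divr_ge0 // ltW.
  by rewrite mulrA divfK // gt_eqF.
rewrite -mulr_suml ler_wpM2r //; apply: le_trans (sum_approval_rate_le R k P).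
by rewrite [leRHS](bigD1 w) //= lerDr approval_rate_ge0.
Qed.

Lemma prob_output_sample_votes_ge (eta L : R) (l : nat)
    (p := approval_rate R k P w) :
  (0 < k)%N -> 0 < eta -> 0 <= L -> 8 * (L + 2) <= l%:R * eta ^+ 2 ->
  4 * eta <= p ->
  (forall c, c != w -> approval_rate R k P c + 4 * eta <= p) ->
  1 - k%:R * expR (- L) <= prob_output R (sample_votes n k t l [::]) P w.
Proof.
move=> k0 eta0 L0 lL pw gap.
have l0 : 0 < l%:R :> R.
  by rewrite lt0r ler0n andbT; apply/eqP => l0; move: lL; rewrite l0; lra.
have := failure_potential_le k0 eta0 L0 lL pw gap; rewrite -/p.
set x := eta / (4 * p); set y := eta / _; set T := _ * l%:R => le.
apply: le_trans (_ : 1 - failure_potential x y T l [::] <= _).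
  by rewrite lerD2l lerN2.
apply: (prob_output_sample_votes (Phi := failure_potential x y T)).
- move=> s; apply: failure_potential0.
  + by rewrite divr_gt0 // mulr_gt0 //; lra.
  + by rewrite divr_gt0 // mulr_gt0 //; lra.
  + by rewrite mulr_gt0 //; lra.
- by move=> l' s; rewrite failure_potentialS.
Qed.
End Sampling.

(** * The algorithm, its correctness and its sample complexity *)

(** The factor 512 is [8 * 8 ^ 2]: the tail bound asks for [8 * (L + 2) <= l * eta ^+ 2], used with
    [eta = eps / 8]. *)
Definition sample_size (R : realType) (k : nat) (eps delta : R) : nat :=
  (Num.trunc (512 * (ln (k%:R / delta) + 2) / eps ^+ 2)).+1.

(* For [eps > 1] the margin can only be infinite, so that the winner does not
   depend on the profile; for [eps * n < 2] the margin need not separate the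
   scores, but reading all votes is cheap. *)
Definition winner_algorithm (R : realType) (n m k : nat)
    (t : {set 'I_m} -> 'I_m) (eps delta : R) : algorithm n m :=
  match n with
  | 0 => read_votes k t (enum 'I_0) [::]
  | n'.+1 =>
      if 1 < eps then Output n'.+1 (winner k t ([ffun=> 1%g] : profile n'.+1 m))
      else if eps * n'.+1%:R < 2 then read_votes k t (enum 'I_n'.+1) [::]
      else sample_votes n' k t (sample_size k eps delta) [::]
  end.

Lemma ln_ratio_ge0 (R : realType) (k : nat) (delta : R) :
  (0 < k)%N -> 0 < delta < 1 -> 0 <= ln (k%:R / delta).
Proof.
move=> k0 /andP[d0 d1]; rewrite ln_ge0 // ler_pdivlMr // mul1r.
by apply: le_trans (ltW d1) _; rewrite ler1n.
Qed.

Lemma winner_algorithm_correct (R : realType) (n m k : nat)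
    (t : {set 'I_m} -> 'I_m) (eps delta : R) :
  (1 <= k <= m)%N -> tie_breaking t -> 0 < eps -> 0 < delta < 1 ->
  solves_winner_determination k t eps delta (winner_algorithm n k t eps delta).
Proof.
move=> /andP[k0 km] tt eps0 d01 P; have [d0 d1] := andP d01.
case: n P => [|n] P mov; rewrite /winner_algorithm.
  by rewrite (prob_output_read_all R k t P); lra.
have n0 : 0 < n.+1%:R :> R by rewrite ltr0n.
have [eps1|eps1] := ltP 1 eps.
  rewrite /=; set P0 : profile n.+1 m := [ffun=> 1%g].
  suff -> : winner k t P0 = winner k t P by rewrite eqxx mulr1n; lra.
  apply/eqP; apply: contraT => neq; exfalso.
  have : (margin_of_victory R k t P <= (num_changed P P0)%:R%:E)%E.
    exact: bigmin_le_cond.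
  move=> /(le_trans mov); rewrite lee_fin leNgt => /negP; apply.
  apply: (@le_lt_trans _ _ n.+1%:R); last by rewrite -[ltLHS]mul1r ltr_pM2r.
  by rewrite ler_nat; apply: leq_trans (max_card _) _; rewrite card_ord.
have [en|en] := ltP (eps * n.+1%:R) 2.
  by rewrite (prob_output_read_all R k t P); lra.
have [mk|mk] := leqP m k.
  apply: (@le_trans _ _ (1 - 0)); first by lra.
  (* All candidates always tie here, so sampling never errs. *)
  apply: (prob_output_sample_votes (Phi := fun _ _ => 0)).
  - by move=> s; rewrite (seq_winner_total t P s mk) eqxx.
  - by move=> l s; rewrite big1 ?mul0r.
set L := ln (k%:R / delta).
have L0 : 0 <= L := ln_ratio_ge0 k0 d01.
have e20 : 0 < eps ^+ 2 by rewrite exprn_gt0.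
have gap c : c != winner k t P ->
    approval_rate R k P c + 4 * (eps / 8) <= approval_rate R k P (winner k t P).
  move=> cw; have k0m : (0 < k < m)%N by rewrite k0 mk.
  have := le_trans mov (margin_of_victory_le_gap R tt (ltn0Sn n) k0m cw).
  rewrite lee_fin => le.
  have sle : (score k P c <= score k P (winner k t P))%N.
    by have := winner_cowinner k P tt; rewrite inE => /forallP.
  rewrite -[leRHS]natr1 natrB // in le.
  by rewrite /approval_rate -(ler_pM2r n0) mulrDl !divfK ?gt_eqF //; lra.
have kd : k%:R * expR (- L) = delta.
  rewrite expRN lnK ?posrE ?divr_gt0 ?ltr0n // invf_div mulrC divfK //.
  by rewrite pnatr_eq0 -lt0n.
rewrite -{1}kd; apply: (@prob_output_sample_votes_ge _ _ _ _ _ _ _ tt (eps / 8)) => //.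
- by rewrite divr_gt0.
- have := truncnS_gt (512 * (L + 2) / eps ^+ 2).
  rewrite -/(sample_size k eps delta) ltr_pdivrMr //; lra.
(* Any rival yields the lower bound on the winner's rate, as rates are nonnegative: candidate 1, or
   0 if 1 wins. *)
- pose c : 'I_m := if winner k t P == Ordinal (leq_ltn_trans k0 mk) then
     Ordinal (ltn_trans k0 mk) else Ordinal (leq_ltn_trans k0 mk).
  have cw : c != winner k t P.
    rewrite /c; case: ifP => [/eqP ->|/negbT]; last by rewrite eq_sym.
    by rewrite -val_eqE.
  by have := gap c cw; have := approval_rate_ge0 R k P c; lra.
Qed.

(** The constant 1025 is [512 * 2] plus 1 for rounding up, as [eps <= 1] when sampling; [c0 <= L]
    absorbs it into a multiple of [L]. Reading all votes happens only if [n * eps < 2], so that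
    [n * eps ^+ 2 < 2]. *)
Lemma winner_algorithm_complexity (R : realType) (n m k : nat)
    (t : {set 'I_m} -> 'I_m) (eps delta c0 : R) :
  (0 < k)%N -> 0 < eps -> 0 < delta < 1 -> 0 < c0 ->
  c0 <= ln (k%:R / delta) ->
  (sample_complexity (winner_algorithm n k t eps delta))%:R
    <= (512 + 1025 / c0) * (ln (k%:R / delta) / eps ^+ 2).
Proof.
move=> k0 eps0 d01 c00; set L := ln _ => cL.
have e20 : 0 < eps ^+ 2 by rewrite exprn_gt0.
have L0 : 0 < L := lt_le_trans c00 cL.
have CL : 512 * L + 1025 <= (512 + 1025 / c0) * L.
  rewrite [leRHS]mulrDl lerD2l mulrAC -mulrA ler_peMr //.
  by rewrite ler_pdivlMr // mul1r.
have bound N : (forall P, (num_queries (winner_algorithm n k t eps delta) P <= N)%N) ->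
    N%:R * eps ^+ 2 <= 512 * L + 1025 ->
    (sample_complexity (winner_algorithm n k t eps delta))%:R
      <= (512 + 1025 / c0) * (L / eps ^+ 2).
  move=> qN NL; apply: (@le_trans _ _ N%:R).
    by rewrite ler_nat; apply/bigmax_leqP => P _; apply: qN.
  by rewrite mulrA ler_pdivlMr //; apply: le_trans CL.
case: n bound => [|n] bound.
  by apply: (bound 0%N) => [P|]; rewrite ?num_queries_read_votes ?size_enum_ord // mul0r; lra.
move: bound; rewrite /winner_algorithm; have [eps1|eps1] := ltP 1 eps.
  by move/(_ 0%N); apply => //; rewrite mul0r; lra.
have e21 : eps ^+ 2 <= eps by rewrite expr2 ger_pMr.
have [en|en] := ltP (eps * n.+1%:R) 2 => bound.
  apply: (bound n.+1) => [P|].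
    by rewrite num_queries_read_votes size_enum_ord.
  by apply: le_trans (_ : n.+1%:R * eps <= _); [rewrite ler_wpM2l | lra].
apply: (bound (sample_size k eps delta)) => [P|].
  exact: num_queries_sample_votes.
rewrite /sample_size -/L -natr1 mulrDl.
have /truncn_itv/andP[tr _] : 0 <= 512 * (L + 2) / eps ^+ 2.
  by rewrite divr_ge0 ?(ltW e20) //; lra.
by move: tr; rewrite ler_pdivlMr //; lra.
Qed.

(* For k = 1 and delta close to 1 the quantity ln (k / delta) tends to 0, while
   a sample complexity is an integer; the implied constant of the O is uniform
   wherever this logarithm is bounded away from 0. *)
Theorem theorem7 (R : realType) :
  exists A : forall (n m k : nat) (t : {set 'I_m} -> 'I_m) (eps delta : R),
      algorithm n m,
    (forall (n m k : nat) (t : {set 'I_m} -> 'I_m) (eps delta : R),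
       (1 <= k <= m)%N -> tie_breaking t -> 0 < eps -> 0 < delta < 1 ->
       solves_winner_determination k t eps delta (A n m k t eps delta)) /\
    (forall c0 : R, 0 < c0 ->
     exists C : R, 0 < C /\
       forall (n m k : nat) (t : {set 'I_m} -> 'I_m) (eps delta : R),
         (1 <= k <= m)%N -> tie_breaking t -> 0 < eps -> 0 < delta < 1 ->
         c0 <= ln (k%:R / delta) ->
         (sample_complexity (A n m k t eps delta))%:R
           <= C * (ln (k%:R / delta) / eps ^+ 2)).
Proof.
exists (fun n m k t eps delta => winner_algorithm n k t eps delta); split.
  exact: winner_algorithm_correct.
move=> c0 c00; exists (512 + 1025 / c0); split; first by rewrite addr_gt0 // divr_gt0.
move=> n m k t eps delta /andP[k0 _] _ eps0 d01.
exact: winner_algorithm_complexity.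
Qed.
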